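(* Let $X$ be a real Hilbert space and let $U,V$ be closed linear subspaces of $X$. Then either $U=V=X$ and $\kappa(P_VP_U)=0$, or $$\kappa(P_VP_U)=\frac{1+c_F}{2+c_F},\quad\text{where } c_F=c_F(U,V)$$ is the cosine of the Friedrichs angle between $U$ and $V$.
   Context: $X$ is a real Hilbert space with inner product $\langle\cdot,\cdot\rangle$ and induced norm $\|\cdot\|$; $\operatorname{Id}$ is the identity operator on $X$. A map $T\colon X\to X$ is nonexpansive if $\|Tx-Ty\|\le\|x-y\|$ for all $x,y\in X$. For $\kappa\in[0,1]$, $T$ is called $\kappa$-averaged if there is a nonexpansive $N\colon X\to X$ with $T=(1-\kappa)\operatorname{Id}+\kappa N$. For a nonexpansive $T\colon X\to X$, the modulus of averagedness is $\kappa(T):=\min\{\kappa\in[0,1] : T \text{ is } \kappa\text{-averaged}\}$ (the minimum is attained). For a closed linear subspace $V$ of $X$, $P_V$ is the orthogonal projection onto $V$ and $V^\perp$ is the orthogonal complement. The cosine of the Friedrichs angle between closed linear subspaces $U,V$ of $X$ is $$c_F(U,V):=\sup\{\langle u,v\rangle : u\in U\cap(U\cap V)^\perp,\ v\in V\cap(U\cap V)^\perp,\ \|u\|\le 1,\ \|v\|\le 1\}.$$ *)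

(* Defs.v *)
From HB Require Import structures.
From mathcomp Require Import all_boot all_order all_algebra sesquilinear.
From mathcomp Require Import boolp classical_sets reals topology normedtype.

Set Implicit Arguments.
Unset Strict Implicit.
Unset Printing Implicit Defensive.

Import Order.TTheory GRing.Theory Num.Theory.
Import numFieldNormedType.Exports.

Local Open Scope classical_set_scope.
Local Open Scope ring_scope.

HB.mixin Record isHilbert (R : realType) X of CompleteNormedModule R X := {
  inner : {dot X for @idfun R} ;
  normr_inner : forall x : X, `|x| ^+ 2 = inner x x
}.

#[short(type="hilbertType")]
HB.structure Definition Hilbert (R : realType) :=
  { X of CompleteNormedModule R X & isHilbert R X }.

Section Averaged.
Context {R : realType} {X : normedModType R}.
Implicit Types (T N : X -> X) (k : R).

Definition nonexpansive T := forall x y, `|T x - T y| <= `|x - y|.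

Definition averaged k T :=
  exists2 N, nonexpansive N & T = (fun x => (1 - k) *: x + k *: N x).

Definition averagedness_constants T : set R :=
  [set k | 0 <= k <= 1 /\ averaged k T].

(* A relation rather than a function, since the minimum need not exist for an
   arbitrary T; it determines k uniquely. *)
Definition is_modulus_of_averagedness T k :=
  averagedness_constants T k /\ lbound (averagedness_constants T) k.

End Averaged.

Section Subspaces.
Context {R : realType} {X : hilbertType R}.
Implicit Types (U V : set X) (x : X).

Definition closed_subspace V := submod_closed [in V] /\ closed V.

Definition orthogonal_complement V : set X :=
  [set x | forall v, V v -> inner x v = 0].

(* For a closed linear subspace V the point p below exists and is unique; the
   default 0 is only used when there is none. *)
Definition orthogonal_projection V x : X :=
  xget 0 [set p | V p /\ orthogonal_complement V (x - p)].

(* The supremum is taken over a set containing 0 and, by Cauchy-Schwarz,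
   bounded by 1, so that the real-valued sup is the actual supremum. *)
Definition cos_friedrichs U V : R :=
  let W := orthogonal_complement (U `&` V) in
  sup [set c | exists u v, [/\ (U `&` W) u, (V `&` W) v,
                              `|u| <= 1, `|v| <= 1 & c = inner u v]].

End Subspaces.

(* Main.v *)
(** Write u = P_U x, w = x - u and v = P_V u.  Expanding squares, T = P_V P_U is
    k-averaged iff
      0 <= (2k - 1) (|u - v|^2 + |w|^2) + 2 (1 - k) <v, w>  for all x.
    If U and V are not both X, T kills a nonzero vector, so k >= 1/2.
    Optimising over w in the orthogonal complement of U, the condition for k < 1
    becomes
      |v - P_U v| <= m |u - v|  for all u in U,  with m = (2k - 1) / (1 - k),
    and m = c for k = (1 + c) / (2 + c), so it remains to see that c = c_F is the
    best constant m in [0, 1].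

    The constant c works: we may assume u orthogonal to the intersection of U and V,
    and then |v| <= c |u| while |v|^2 = <P_U v, u> <= |P_U v| |u|.

    Conversely, let m < 1 work.  For z = y - P_V y with y in U the inequality says
    (1 - m^2) |z|^2 <= |P_U z|^2, and <u, P_U z> = <u - P_V u, z>.  The vectors P_U z
    approximate every u in U orthogonal to the intersection, whence
    (1 - m^2) |u|^2 <= |u - P_V u|^2, that is |P_V u| <= m |u|, and c <= m. *)

Require Import Defs.
From mathcomp Require Import all_boot all_order all_algebra.
From mathcomp Require Import boolp classical_sets reals topology normedtype.
From mathcomp Require Import sesquilinear ring lra.
Import Order.TTheory GRing.Theory Num.Theory numFieldNormedType.Exports.

Local Open Scope classical_set_scope.
Local Open Scope ring_scope.

(** * Inner product identities and the Cauchy-Schwarz inequality *)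

Section InnerProduct.
Context {R : realType} {X : hilbertType R}.
Implicit Types (x y z : X) (a : R).

Lemma innerC x y : inner x y = inner y x.
Proof. by rewrite (@hermC R false idfun X (@inner R X)) expr0 mul1r. Qed.

Lemma innerDl x y z : inner (x + y) z = inner x z + inner y z.
Proof. exact: linearDl. Qed.

Lemma innerDr x y z : inner z (x + y) = inner z x + inner z y.
Proof. exact: linearDr. Qed.

Lemma innerNl x z : inner (- x) z = - inner x z.
Proof. exact: linearNl. Qed.

Lemma innerNr x z : inner z (- x) = - inner z x.
Proof. exact: linearNr. Qed.

Lemma innerZl a x z : inner (a *: x) z = a * inner x z.
Proof. exact: linearZl_LR. Qed.

Lemma innerZr a x z : inner z (a *: x) = a * inner z x.
Proof. by rewrite innerC innerZl innerC. Qed.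

Definition innerE := (innerDl, innerDr, innerNl, innerNr, innerZl, innerZr).

Lemma inner_ge0 x : 0 <= inner x x.
Proof. by rewrite -normr_inner exprn_ge0. Qed.

Lemma inner_eq0 x : inner x x = 0 -> x = 0.
Proof.
by move=> /eqP; rewrite -normr_inner expf_eq0 /= normr_eq0 => /eqP.
Qed.

Lemma inner0 x : inner 0 x = 0.
Proof. by rewrite -(scale0r x) innerZl mul0r. Qed.

Lemma cauchy_schwarz x y : inner x y <= `|x| * `|y|.
Proof.
have [-> |x0] := eqVneq x 0; first by rewrite inner0 normr0 mul0r.
have [-> |y0] := eqVneq y 0; first by rewrite innerC inner0 normr0 mulr0.
have xy0 : 0 < `|x| * `|y| by rewrite mulr_gt0 ?normr_gt0.
(* The square of this vector is 2 |x| |y| (|x| |y| - <x, y>). *)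
have := inner_ge0 (`|y| *: x - `|x| *: y).
rewrite !innerE -!normr_inner (innerC y x) => h.
rewrite -(ler_pM2l xy0); nra.
Qed.

End InnerProduct.

(** * Best approximation, and continuity of the inner product *)

Section Projection.
Context {R : realType} {X : hilbertType R}.
Implicit Types (K V : set X) (x y v : X) (a : R).

Lemma submod_lin K a x y : submod_closed [in K] -> K x -> K y -> K (a *: x + y).
Proof.
move=> [_ h] Kx Ky; have := h a x y; rewrite !inE; exact.
Qed.

Lemma submod0 K : submod_closed [in K] -> K 0.
Proof. by move=> [h _]; rewrite inE in h. Qed.

Lemma submodZ K a x : submod_closed [in K] -> K x -> K (a *: x).
Proof.
by move=> h Kx; rewrite -[_ *: _]addr0; apply: submod_lin => //; exact: submod0.
Qed.

Lemma submodD K x y : submod_closed [in K] -> K x -> K y -> K (x + y).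
Proof. by move=> h Kx Ky; rewrite -[x]scale1r; exact: submod_lin. Qed.

Lemma submodB K x y : submod_closed [in K] -> K x -> K y -> K (x - y).
Proof. by move=> h Kx Ky; rewrite -scaleN1r addrC; exact: submod_lin. Qed.

(** [K] is not assumed closed: besides closed subspaces, this serves for a range that may fail to be
    closed. The point p is the limit of near-minimisers of the distance from x to [K]. *)
Lemma closure_projection K x : submod_closed [in K] ->
  exists2 p, closure K p & orthogonal_complement K (x - p).
Proof.
move=> subK.
pose S := [set `|x - y| ^+ 2 | y in K].
pose D := inf S.
have infS : has_inf S.
  split; first by exists (`|x - 0| ^+ 2), 0 => //; exact: submod0.
  by exists 0 => _ [y _ <-]; rewrite exprn_ge0.
have leD y : K y -> D <= `|x - y| ^+ 2.
  by move=> Ky; apply: ge_inf; [case: infS|exists y].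
pose A e := [set y | K y /\ `|x - y| ^+ 2 < D + e].
pose F := filter_from [set e : R | 0 < e] A.
have A0 e : 0 < e -> A e !=set0.
  by move=> e0; have [_ [y Ky <-] ye] := inf_adherent e0 infS; exists y.
have FF : ProperFilter F.
  apply: filter_from_proper => //.
  apply: filter_from_filter; first by exists 1 => /=.
  move=> e f /= e0 f0; exists (Num.min e f); first by rewrite /= lt_min e0.
  move=> y [Ky]; rewrite -ltrBlDl lt_min !ltrBlDl => /andP[ye yf].
  by split; split.
(* Parallelogram identity: the midpoint of y and z lies in [K], so its squared distance to x is at
   least [D]. *)
have small e y z : A e y -> A e z -> `|y - z| ^+ 2 <= 4 * e.
  move=> [Ky ye] [Kz ze].
  have := leD _ (submodZ _ 2^-1 _ subK (submodD _ _ _ subK Ky Kz)).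
  move: ye ze; rewrite !normr_inner !innerE.
  rewrite (innerC y x) (innerC z x) (innerC z y) => ye ze.
  move=> le; lra.
have cF : cauchy F.
  apply/cauchyP => e /= e0.
  have d0 : 0 < e ^+ 2 / 8 by rewrite divr_gt0 ?exprn_gt0.
  have [y Ay] := A0 _ d0; exists y; exists (e ^+ 2 / 8) => //= z Az.
  rewrite -ball_normE /= -ltr_sqr ?nnegrE ?(ltW e0)//.
  have := small _ _ _ Ay Az; lra.
have [p Fp] : exists p : X, F --> p by apply/cvg_ex; exact: (cauchy_cvg F cF).
have nearF e : 0 < e -> F (A e) by move=> e0; exists e.
(* As p may lie outside [K], both bounds on distances are obtained as limits along [F]: t = 0 yields
   the upper one, v in [K] the lower one. *)
have cvn t v : (`|x + t *: v - y| ^+ 2) @[y --> F] --> `|x + t *: v - p| ^+ 2.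
  have h : `|x + t *: v - y| @[y --> F] --> `|x + t *: v - p|.
    by apply: cvg_norm; apply: cvgB => //; exact: cvg_cst.
  by rewrite expr2; under eq_fun do rewrite expr2; exact: cvgM.
have pD e : 0 < e -> `|x - p| ^+ 2 <= D + e.
  move=> e0; have := cvn 0 0; rewrite scaler0 addr0 => h.
  apply: (cvgr_to_le h).
  by apply: filterS (nearF _ e0) => y [_ /ltW].
have {}pD : `|x - p| ^+ 2 <= D by apply/ler_addgt0Pr.
have Dp t v : K v -> D <= `|x + t *: v - p| ^+ 2.
  move=> Kv.
  apply: (cvgr_to_ge (cvn t v)).
  apply: filterS (nearF _ ltr01) => y [Ky _] /=.
  rewrite (_ : x + _ - y = x - ((- t) *: v + y)) ?leD//.
    exact: submod_lin.
  by rewrite opprD scaleNr opprK addrA.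
exists p.
  move=> B Bp.
  have [e e0 AB] : F B by exact: Fp.
  by have [y Ay] := A0 _ e0; exists y; split; [case: Ay|exact: AB].
move=> v Kv.
have h t : 0 <= 2 * t * inner (x - p) v + t ^+ 2 * inner v v.
  have := le_trans pD (Dp t v Kv); rewrite addrAC !normr_inner !innerE.
  rewrite (innerC v x) (innerC v p); lra.
have b0 := inner_ge0 v.
set a := inner _ _ in h *; set b := inner v v in h b0.
have b1 : 0 < b + 1 by lra.
(* The minimiser is - a / b; adding 1 avoids the case v = 0. *)
have := h (- a / (b + 1)).
have -> : 2 * (- a / (b + 1)) * a + (- a / (b + 1)) ^+ 2 * b =
   - ((b + 2) * (a / (b + 1)) ^+ 2) by field; lra.
rewrite oppr_ge0 pmulr_rle0 ?exprn_even_le0//=; last lra.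
by rewrite mulf_eq0 invr_eq0 (gt_eqF b1) orbF => /eqP.
Qed.

(** Polarization reduces this to continuity of the norm. *)
Lemma inner_continuous v : continuous (inner v : X -> R).
Proof.
move=> x; have normC (f : X -> X) : f y @[y --> x] --> f x ->
    (inner (f y) (f y) : R) @[y --> x] --> (inner (f x) (f x) : R).
  move=> cf; under eq_fun do rewrite -normr_inner expr2.
  by rewrite -normr_inner expr2; apply: cvgM; apply: cvg_norm.
have polar y : inner v y =
    2^-1 * (inner (v + y) (v + y) - inner y y - inner v v).
  by rewrite !innerE (innerC y v); lra.
rewrite (funext polar).
have cD : v + y @[y --> x] --> v + x by apply: cvgD => //; exact: cvg_cst.
apply: cvgM; first exact: cvg_cst.
apply: cvgB; last exact: cvg_cst.
exact: cvgB (normC _ cD) (normC id _).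
Qed.

Lemma closed_orthogonal_complement V : closed (orthogonal_complement V).
Proof.
rewrite (_ : orthogonal_complement V =
    \bigcap_(v in V) [set x | inner v x = 0]).
  apply: closed_bigI => v _.
  apply: (@closed_comp X R (inner v) [set c : R | c = 0]); last exact: closed_eq.
  by move=> x _; exact: inner_continuous.
by apply/seteqP; split=> x h v Vv; [have := h v Vv|]; rewrite /= innerC//; exact: h.
Qed.

End Projection.

(** * Orthogonal projection onto a closed subspace *)

Section OrthogonalProjection.
Context {R : realType} {X : hilbertType R}.
Context (V : set X) (clV : closed_subspace V).
Implicit Types (x y v : X) (a : R).
Let P := orthogonal_projection V.

Lemma orthogonal_projectionP x : V (P x) /\ orthogonal_complement V (x - P x).
Proof.
have [subV cV] := clV; rewrite /P /orthogonal_projection.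
apply: (xgetPex 0 (P := [set p | V p /\ orthogonal_complement V (x - p)])).
have [p Vp xp] := closure_projection V x subV.
by exists p; split=> //; rewrite ((closure_id V).1 cV).
Qed.

Lemma orthogonal_projection_in x : V (P x).
Proof. by have [] := orthogonal_projectionP x. Qed.

Lemma inner_projection x v : V v -> inner (P x) v = inner x v.
Proof.
have [_ h] := orthogonal_projectionP x => /h.
by rewrite innerDl innerNl => /eqP; rewrite subr_eq0 => /eqP.
Qed.

Lemma orthogonal_projection_unique x v :
  V v -> orthogonal_complement V (x - v) -> P x = v.
Proof.
move=> Vv xv; apply/eqP; rewrite -subr_eq0; apply/eqP/inner_eq0.
have VPv : V (P x - v).
  by apply: submodB => //; [exact: clV.1|exact: orthogonal_projection_in].
(* Since P x - v lies in V, <P x - v, P x - v> = <x - v, P x - v> = 0. *)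
have := xv _ VPv.
by rewrite innerDl innerNl -inner_projection// -innerNl -innerDl.
Qed.

Lemma orthogonal_projection_id v : V v -> P v = v.
Proof.
by move=> Vv; apply: orthogonal_projection_unique => // y _; rewrite subrr inner0.
Qed.

Lemma orthogonal_projection_eq0 x : orthogonal_complement V x -> P x = 0.
Proof.
move=> xV; apply: orthogonal_projection_unique; first exact: submod0 clV.1.
by rewrite subr0.
Qed.

Lemma orthogonal_projection_lin a x y : P (a *: x + y) = a *: P x + P y.
Proof.
apply: orthogonal_projection_unique => [|v Vv].
  by apply: submod_lin; [exact: clV.1|exact: orthogonal_projection_in..].
by rewrite !innerE !inner_projection//; lra.
Qed.

Lemma orthogonal_projectionB x y : P (x - y) = P x - P y.
Proof.
by rewrite -scaleN1r addrC orthogonal_projection_lin scaleN1r addrC.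
Qed.

Lemma normr_projection x : `|x| ^+ 2 = `|P x| ^+ 2 + `|x - P x| ^+ 2.
Proof.
rewrite !normr_inner !innerE (innerC x (P x)).
have := inner_projection x _ (orthogonal_projection_in x).
by rewrite (innerC x); lra.
Qed.

End OrthogonalProjection.


(** * The Friedrichs cosine as the best constant *)

Section FriedrichsAngle.
Context {R : realType} {X : hilbertType R}.
Context (U V : set X) (clU : closed_subspace U) (clV : closed_subspace V).
Implicit Types (u v x y : X) (m : R).
Let P := orthogonal_projection V.
Let Q := orthogonal_projection U.
Let W := orthogonal_complement (U `&` V).
Let c := cos_friedrichs U V.
Let PV := orthogonal_projection_in V clV.
Let QU := orthogonal_projection_in U clU.

Lemma closed_subspaceI : closed_subspace (U `&` V).
Proof.
have [sU cU] := clU; have [sV cV] := clV; split; last exact: closedI.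
split=> [|a x y]; rewrite !inE; first by split; exact: submod0.
by move=> [Ux Vx] [Uy Vy]; split; exact: submod_lin.
Qed.

Let S := [set a | exists u v, [/\ (U `&` W) u, (V `&` W) v,
                              `|u| <= 1, `|v| <= 1 & a = inner u v]].

Let S0 : S 0.
Proof.
exists 0, 0; rewrite normr0 inner0 ler01; split=> //; split.
- exact: submod0 clU.1.
- by move=> ? _; rewrite inner0.
- exact: submod0 clV.1.
- by move=> ? _; rewrite inner0.
Qed.

Let S1 : ubound S 1.
Proof.
move=> _ [u [v [_ _ u1 v1 ->]]]; apply: le_trans (cauchy_schwarz u v) _.
by rewrite mulr_ile1.
Qed.

Lemma cos_friedrichs_ge0 : 0 <= c.
Proof. by apply: ub_le_sup => //; exists 1. Qed.

Lemma cos_friedrichs_le1 : c <= 1.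
Proof. by apply: ge_sup => //; exists 0. Qed.

Lemma inner_le_cos_friedrichs u v :
  U u -> W u -> V v -> W v -> inner u v <= c * (`|u| * `|v|).
Proof.
move=> Uu Wu Vv Wv.
have [->|u0] := eqVneq u 0; first by rewrite inner0 normr0 mul0r mulr0.
have [->|v0] := eqVneq v 0.
  by rewrite innerC inner0 normr0 !mulr0.
have uv0 : 0 < `|u| * `|v| by rewrite mulr_gt0 ?normr_gt0.
have scale1 x : x != 0 -> `| `|x|^-1 *: x| <= 1.
  by move=> x0; rewrite normrZ normfV normr_id mulVf ?normr_eq0.
rewrite -ler_pdivrMr// invfM mulrC -mulrA (_ : _ * _ =
  inner (`|u|^-1 *: u) (`|v|^-1 *: v)); last by rewrite innerZl innerZr.
apply: ub_le_sup; first by exists 1.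
have WZ a x : W x -> W (a *: x).
  by move=> Wx y /Wx; rewrite innerZl => ->; rewrite mulr0.
exists (`|u|^-1 *: u), (`|v|^-1 *: v); split=> //; rewrite ?scale1//; split.
- exact: submodZ clU.1 Uu.
- exact: WZ.
- exact: submodZ clV.1 Vv.
- exact: WZ.
Qed.

Lemma projection_projection_le u : U u ->
  `|P u - Q (P u)| ^+ 2 <= c ^+ 2 * `|u - P u| ^+ 2.
Proof.
(* Both projections fix the component of u in the intersection, so subtracting it changes neither
   side. *)
wlog Wu : u / W u => [hW Uu|Uu].
  have [[Uw Vw] ww] := orthogonal_projectionP (U `&` V) closed_subspaceI u.
  set w := orthogonal_projection _ u in Uw Vw ww.
  have := hW (u - w) ww (submodB _ _ _ clU.1 Uu Uw).
  rewrite /P orthogonal_projectionB// (orthogonal_projection_id V _ w)//.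
  rewrite /Q orthogonal_projectionB// (orthogonal_projection_id U _ w)//.
  have sub2 a b : a - w - (b - w) = a - b :> X by rewrite opprB addrA subrK.
  by rewrite !sub2; exact.
have Wv : W (P u).
  by move=> w [Uw Vw]; rewrite inner_projection//; exact: Wu.
set v := P u in Wv *; set s := Q v.
have uv : inner u v = `|v| ^+ 2.
  by rewrite normr_inner /v inner_projection//; exact: PV.
have Vv : V v by exact: PV.
have c0 := cos_friedrichs_ge0.
have rp : `|v| ^+ 2 <= `|s| * `|u|.
  by rewrite -uv innerC -(inner_projection U) //; exact: cauchy_schwarz.
have qp := inner_le_cos_friedrichs u v Uu Wu Vv Wv; rewrite uv in qp.
have := normr_projection U clU v; have := normr_projection V clV u.
rewrite -/v -/s -/P => up us.
have -> : `|u - v| ^+ 2 = `|u| ^+ 2 - `|v| ^+ 2 by lra.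
have -> : `|v - s| ^+ 2 = `|v| ^+ 2 - `|s| ^+ 2 by lra.
have uv2 : 0 <= `|u| ^+ 2 - `|v| ^+ 2 by rewrite up addrAC subrr add0r exprn_ge0.
move: c0 rp qp uv2; rewrite -/c.
have := normr_ge0 u; have := normr_ge0 v; have := normr_ge0 s.
move: (`|u|) (`|v|) (`|s|) (c) => p q r k r0 q0 p0 k0 rp qp uv2.
have [q00|q_neq0] := eqVneq q 0.
  rewrite q00 expr0n/= sub0r subr0 (@le_trans _ _ 0)//.
    by rewrite oppr_le0 exprn_ge0.
  by rewrite mulr_ge0 ?exprn_ge0.
have qgt0 : 0 < q by rewrite lt_def q_neq0.
have pgt0 : 0 < p.
  rewrite lt_def p0 andbT; apply: contraNneq q_neq0 => p00.
  by move: rp; rewrite p00 mulr0 exprn_even_le0//.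
have {}qp : q <= k * p by rewrite -(ler_pM2r qgt0) -expr2 -mulrA.
have q2 : q ^+ 2 <= k ^+ 2 * p ^+ 2 by rewrite -exprMn ler_sqr ?nnegrE ?mulr_ge0.
have q4 : (q ^+ 2) ^+ 2 <= r ^+ 2 * p ^+ 2.
  by rewrite -exprMn ler_sqr ?nnegrE ?mulr_ge0 ?exprn_ge0.
(* After multiplication by p^2: p^2 q^2 - p^2 r^2 <= q^2 (p^2 - q^2) by [q4], and this is at most
   k^2 p^2 (p^2 - q^2) by [q2]. *)
rewrite -(ler_pM2l (exprn_gt0 2 pgt0)).
have := ler_wpM2r uv2 q2; lra.
Qed.


Lemma cos_friedrichs_le m : 0 <= m < 1 ->
  (forall u, U u -> `|P u - Q (P u)| ^+ 2 <= m ^+ 2 * `|u - P u| ^+ 2) ->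
  c <= m.
Proof.
move=> /andP[m0 m1] H.
have m2 : 0 <= 1 - m ^+ 2 by rewrite subr_ge0 expr_le1// ltW.
pose k := Num.sqrt (1 - m ^+ 2).
have k2 : k ^+ 2 = 1 - m ^+ 2 by rewrite sqr_sqrtr.
have k0 : 0 <= k by exact: sqrtr_ge0.
pose K := [set Q (y - P y) | y in U].
have subK : submod_closed [in K].
  split=> [|a x y]; rewrite !inE.
    exists 0; first exact: submod0 clU.1.
    have V0 := submod0 _ clV.1; have U0 := submod0 _ clU.1.
    by rewrite /P orthogonal_projection_id// subrr /Q orthogonal_projection_id.
  move=> [x' Ux <-] [y' Uy <-]; exists (a *: x' + y').
    exact: submod_lin clU.1 _ _.
  rewrite -orthogonal_projection_lin//; congr Q.
  by rewrite /P orthogonal_projection_lin// scalerBr opprD addrACA.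
have KU : closure K `<=` U.
  rewrite closureE; apply: smallest_sub; first exact: clU.2.
  by move=> _ [y _ <-]; exact: QU.
(* The residual e is orthogonal to [K], in particular to Q (e - P e), which gives |e - P e|^2 = 0.
   So e lies in both subspaces and is orthogonal to u; it is also orthogonal to p, a limit of points
   of [K]. Hence e = 0. *)
have denseK u : U u -> W u -> closure K u.
  move=> Uu Wu; have [p Kp up] := closure_projection K u subK.
  set e := u - p in up.
  have Ue : U e by apply: submodB clU.1 Uu (KU _ Kp).
  have /eqP : inner e (Q (e - P e)) = 0 by apply: up; exists e.
  rewrite innerC inner_projection// -[X in inner _ X](subrK (P e)) innerDr.
  rewrite ((orthogonal_projectionP V clV e).2 _ (PV e)) addr0.
  move=> /eqP/inner_eq0/eqP; rewrite subr_eq0 => /eqP eP.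
  have Ve : V e by rewrite eP; exact: PV.
  have pe : orthogonal_complement [set e] p.
    suff : closure K `<=` orthogonal_complement [set e] by exact.
    rewrite closureE; apply: smallest_sub; first exact: closed_orthogonal_complement.
    by move=> y Ky _ ->; rewrite innerC up.
  have /inner_eq0/eqP : inner e e = 0.
    by rewrite {1}/e innerDl innerNl pe// Wu// subr0.
  by rewrite subr_eq0 => /eqP ->.
(* The condition on y is closed, so it suffices to check it on [K], by Cauchy-Schwarz and the lower
   bound k |z| <= |Q z|. *)
have ineqK u : U u -> closure K `<=` [set y | k * inner u y <= `|u - P u| * `|y|].
  move=> Uu; set C := [set y | _].
  have clC : closed C.
    rewrite (_ : C = (fun y => k * inner u y - `|u - P u| * `|y|) @^-1`
      [set r : R | r <= 0]); last by apply/funext => y /=; rewrite subr_le0.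
    apply: closed_comp; last exact: closed_le.
    move=> y _; apply: cvgB; apply: cvgM; try exact: cvg_cst.
      exact: inner_continuous.
    exact: cvg_norm.
  rewrite closureE; apply: smallest_sub => // _ [y Uy <-].
  rewrite /C/=; set z := y - P y.
  have zV : orthogonal_complement V z by exact: (orthogonal_projectionP V clV y).2.
  have -> : inner u (Q z) = inner (u - P u) z.
    rewrite innerC inner_projection// innerDl innerNl (innerC (P u)).
    by rewrite (zV _ (PV u)) subr0 innerC.
  have kz : k * `|z| <= `|Q z|.
    rewrite -ler_sqr ?nnegrE ?mulr_ge0// exprMn k2.
    have := normr_projection U clU z; have := H y Uy; rewrite -/z.
    (* As Q y = y, the hypothesis at y bounds |z - Q z| by m |z|; Pythagoras then bounds |Q z| from
       below. *)
    have -> : z - Q z = - (P y - Q (P y)).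
      rewrite {2}/z /Q orthogonal_projectionB// (orthogonal_projection_id U _ y)//.
      by rewrite /z !opprB addrC addrA subrK.
    by rewrite normrN => h1 h2; lra.
  have := cauchy_schwarz (u - P u) z; have := normr_ge0 (u - P u).
  move: kz k0; move: (inner _ z) (`|u - P u|) (`|z|) (`|Q z|) => i d n q; nra.
(* Taking y = u in [ineqK] gives k |u| <= |u - P u|. *)
have contr u : U u -> W u -> `|P u| <= m * `|u|.
  move=> Uu Wu; have /= := ineqK u Uu u (denseK u Uu Wu).
  have [->|u0] := eqVneq u 0.
    rewrite /P orthogonal_projection_id ?normr0 ?mulr0//; exact: submod0 clV.1.
  rewrite -normr_inner expr2 mulrA ler_pM2r ?normr_gt0// => ku.
  rewrite -ler_sqr ?nnegrE ?mulr_ge0// exprMn.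
  have := normr_projection V clV u; rewrite -/P.
  have : (k * `|u|) ^+ 2 <= `|u - P u| ^+ 2.
    by rewrite ler_sqr ?nnegrE ?mulr_ge0.
  by rewrite exprMn k2; lra.
apply: ge_sup; first by exists 0.
move=> _ [u [v [[Uu Wu] [Vv Wv] u1 v1 ->]]].
rewrite -(inner_projection V)//.
apply: le_trans (cauchy_schwarz _ _) _.
have := contr u Uu Wu; have := normr_ge0 (P u).
move: u1 v1; move: (normr_ge0 u) (normr_ge0 v) m0.
rewrite -/P; move: (`|P u|) (`|u|) (`|v|) (m) => a b d e *.
apply: (@le_trans _ _ (a * 1)); first by rewrite ler_wpM2l.
by rewrite mulr1; apply: (@le_trans _ _ (e * b)) => //; rewrite ler_piMr.
Qed.

End FriedrichsAngle.

(** * Averagedness as a norm inequality *)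

Section AveragednessCriterion.
Context {R : realType} {X : normedModType R}.
Implicit Types (T : X -> X) (k : R).

Lemma averaged_normr_le T k x : T 0 = 0 -> 0 <= k -> averaged k T ->
  `|T x - (1 - k) *: x| <= k * `|x|.
Proof.
move=> T0 k0 [N Nne TE].
(* Only the multiple is determined: [N 0] is arbitrary when k = 0. *)
have N0 : k *: N 0 = 0 by move: T0; rewrite TE scaler0 add0r.
rewrite TE addrAC subrr add0r -(subr0 (k *: N x)) -N0 -scalerBr normrZ.
by rewrite ger0_norm// ler_wpM2l// -[in leRHS](subr0 x) Nne.
Qed.

(** Solving for [N] gives a difference-preserving map, for which a norm bound amounts to
    nonexpansiveness. *)
Lemma normr_le_averaged T k : (forall x y, T (x - y) = T x - T y) -> 0 < k ->
  (forall x, `|T x - (1 - k) *: x| <= k * `|x|) -> averaged k T.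
Proof.
move=> TB k0 Tle; exists (fun x => k^-1 *: (T x - (1 - k) *: x)).
  move=> x y; rewrite -scalerBr normrZ gtr0_norm ?invr_gt0//.
  rewrite ler_pdivrMl//; apply: le_trans (Tle (x - y)).
  by rewrite TB scalerBr !opprD addrACA.
by apply/funext => x; rewrite scalerA divff ?gt_eqF// scale1r addrC subrK.
Qed.

End AveragednessCriterion.

(** * The modulus of the composed projections *)

Section ModulusOfAveragedness.
Context {R : realType} {X : hilbertType R}.
Context (U V : set X) (clU : closed_subspace U) (clV : closed_subspace V).
Implicit Types (x u : X) (k : R).
Let P := orthogonal_projection V.
Let Q := orthogonal_projection U.
Let T := P \o Q.
Let c := cos_friedrichs U V.

Let T0 : T 0 = 0.
Proof. by rewrite /T /P /Q /= !orthogonal_projection_eq0// => v _; rewrite inner0. Qed.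

Let TB x y : T (x - y) = T x - T y.
Proof. by rewrite /T /P /Q /= !orthogonal_projectionB. Qed.

(** The right side is the difference of the two squared norms, simplified by <w, u> = 0 and <u, v> =
    |v|^2. *)
Lemma averaged_ineqE k x : 0 <= k ->
  let u := Q x in let v := P u in let w := x - u in
  (`|T x - (1 - k) *: x| <= k * `|x|) =
  (0 <= (2 * k - 1) * (`|u - v| ^+ 2 + `|w| ^+ 2) + 2 * (1 - k) * inner v w).
Proof.
move=> k0 u v w.
rewrite -ler_sqr ?nnegrE ?mulr_ge0// exprMn -subr_ge0; congr (0 <= _).
have xuw : x = u + w by rewrite addrC subrK.
have wu : inner w u = 0.
  by apply: (orthogonal_projectionP U clU x).2; exact: orthogonal_projection_in.
have uv : inner u v = inner v v.
  by rewrite -(inner_projection V clV u)//; exact: orthogonal_projection_in.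
have -> : T x = v by [].
clearbody w v u; rewrite xuw !normr_inner !innerE.
by rewrite (innerC u w) wu (innerC v u) uv (innerC w v); ring.
Qed.

Lemma averaged_composition_projections : averaged ((1 + c) / (2 + c)) T.
Proof.
have c0 : 0 <= c := cos_friedrichs_ge0 U V clU clV.
set k := _ / _; have c2 : 0 < 2 + c by lra.
have k0 : 0 < k by rewrite divr_gt0//; lra.
apply: normr_le_averaged => // x.
rewrite averaged_ineqE ?(ltW k0)//.
set u := Q x; set v := P u; set w := x - u.
have Uu : U u by exact: orthogonal_projection_in.
rewrite -(pmulr_rge0 _ c2).
(* Here (2 + c) (2 k - 1) = c and (2 + c) (1 - k) = 1. *)
have -> : (2 + c) * ((2 * k - 1) * (`|u - v| ^+ 2 + `|w| ^+ 2) +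
    2 * (1 - k) * inner v w) =
    c * (`|u - v| ^+ 2 + `|w| ^+ 2) + 2 * inner v w.
  by rewrite /k; field; lra.
(* w is orthogonal to U, so only the component v - Q v counts; the sign makes Cauchy-Schwarz a lower
   bound for <v, w>. *)
have vw : inner v w = - inner (v - Q v) (- w).
  rewrite innerNr opprK innerDl innerNl (innerC (Q v)).
  by rewrite (orthogonal_projectionP U clU x).2 ?subr0//;
    exact: orthogonal_projection_in.
have := cauchy_schwarz (v - Q v) (- w); rewrite normrN vw.
have : `|v - Q v| <= c * `|u - v|.
  rewrite -ler_sqr ?nnegrE ?mulr_ge0// exprMn.
  exact: projection_projection_le.
have := normr_ge0 w; have := normr_ge0 (u - v).
move: (inner _ _) (`|w|) (`|u - v|) (`|v - Q v|) => i o d b d0 o0 bd ib.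
have : b * o <= c * d * o by rewrite ler_wpM2r.
have : 0 <= c * (d - o) ^+ 2 by rewrite mulr_ge0 ?exprn_even_ge0.
lra.
Qed.

(** A nonzero x with T x = 0 exists in the orthogonal complement of U, or of V when U is the whole
    space; there the criterion reads |1 - k| |x| <= k |x|. *)
Lemma averaged_ge_half k : ~ (U = setT /\ V = setT) -> 0 <= k ->
  averaged k T -> 1 <= 2 * k.
Proof.
move=> UV k0 avk.
have [x x0 Tx] : exists2 x, x != 0 & T x = 0.
  have nT A : A <> setT -> exists y : X, ~ A y.
    move=> AT; apply/existsNP => allA; apply: AT.
    by apply/seteqP; split=> // y _; exact: allA.
  have neq0 (A : set X) y : closed_subspace A -> ~ A y ->
      y - orthogonal_projection A y != 0.
    move=> clA; apply: contra_not_neq => /eqP; rewrite subr_eq0 => /eqP ->.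
    exact: orthogonal_projection_in.
  have [UT|/nT[y Uy]] := pselect (U = setT).
    have [VT|/nT[y Vy]] := pselect (V = setT); first by case: UV.
    exists (y - P y); first exact: neq0.
    rewrite /T /= /Q orthogonal_projection_id//; last by rewrite UT.
    by apply: orthogonal_projection_eq0 => //;
      exact: (orthogonal_projectionP V clV y).2.
  exists (y - Q y); first exact: neq0.
  rewrite /T /= {1}/Q orthogonal_projection_eq0//.
    by apply: orthogonal_projection_eq0 => // v _; rewrite inner0.
  exact: (orthogonal_projectionP U clU y).2.
have := averaged_normr_le _ _ x T0 k0 avk.
rewrite Tx sub0r normrN normrZ ler_pM2r ?normr_gt0// => /(le_trans (ler_norm _)).
lra.
Qed.

Lemma averaged_ge k : ~ (U = setT /\ V = setT) -> 0 <= k <= 1 ->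
  averaged k T -> (1 + c) / (2 + c) <= k.
Proof.
move=> UV /andP[k0 k1] avk.
have c0 : 0 <= c := cos_friedrichs_ge0 U V clU clV.
have c1 : c <= 1 := cos_friedrichs_le1 U V clU clV.
have k2 := averaged_ge_half _ UV k0 avk.
rewrite ler_pdivrMr; last lra.
(* 2 / 3 is the value of (1 + c) / (2 + c) at c = 1, its maximum; below it, m < 1. *)
have [k23|k23] := lerP (2 / 3) k.
  by have : 0 <= (3 * k - 2) * (2 + c); [rewrite mulr_ge0//; lra|lra].
have k1' : 0 < 1 - k by lra.
pose m := (2 * k - 1) / (1 - k).
have mE : m * (1 - k) = 2 * k - 1 by rewrite divfK// gt_eqF.
have m01 : 0 <= m < 1.
  by rewrite divr_ge0 ?ltr_pdivrMr//=; lra.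
suff : c <= m by move=> cm; have := ler_wpM2r (ltW k1') cm; lra.
apply: cos_friedrichs_le => // u Uu; rewrite -/P -/Q.
(* The averagedness criterion at x = u - t (P u - Q (P u)). *)
have ineq t : 0 <= m * (`|u - P u| ^+ 2 + t ^+ 2 * `|P u - Q (P u)| ^+ 2) -
    2 * t * `|P u - Q (P u)| ^+ 2.
  have wU := (orthogonal_projectionP U clU (P u)).2.
  pose w := P u - Q (P u); rewrite -/w in wU *.
  have wUu v : U v -> inner w v = 0 by exact: wU.
  have Qx : Q (u - t *: w) = u.
    apply: orthogonal_projection_unique => // v Uv.
    by rewrite addrAC subrr add0r innerNl innerZl wUu// mulr0 oppr0.
  have := averaged_normr_le _ _ (u - t *: w) T0 k0 avk.
  rewrite averaged_ineqE// Qx (addrAC u) subrr add0r.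
  rewrite normrN normrZ exprMn real_normK ?num_real// innerNr innerZr.
  have -> : inner (P u) w = `|w| ^+ 2.
    rewrite normr_inner {2}/w innerDl innerNl (innerC (Q _)) wUu ?subr0//.
    exact: orthogonal_projection_in.
  rewrite -mE => h; rewrite -(pmulr_rge0 _ k1').
  by move: h; congr (0 <= _); ring.
move: ineq m01; move: (`|u - P u| ^+ 2) (exprn_ge0 2 (normr_ge0 (P u - Q (P u)))).
move: (`|P u - Q (P u)| ^+ 2) (m) => b n d b0 ineq /andP[n0 _].
(* For n > 0 the quadratic in t is minimal at t = 1 / n; for n = 0 it is linear and t = 1 forces b
   <= 0. *)
have [n00|n_neq0] := eqVneq n 0.
  by have := ineq 1; rewrite n00 expr0n /= !mul0r; lra.
have ngt0 : 0 < n by rewrite lt_def n_neq0.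
have := ineq n^-1.
have -> : n * (d + n^-1 ^+ 2 * b) - 2 / n * b = (n ^+ 2 * d - b) / n by field.
by rewrite pmulr_lge0 ?invr_gt0// subr_ge0.
Qed.


End ModulusOfAveragedness.

Theorem corollary3p3 (R : realType) (X : hilbertType R) (U V : set X)
    (clU : closed_subspace U) (clV : closed_subspace V) :
  let T := orthogonal_projection V \o orthogonal_projection U in
  let cF := cos_friedrichs U V in
  [/\ U = setT, V = setT & is_modulus_of_averagedness T 0] \/
  is_modulus_of_averagedness T ((1 + cF) / (2 + cF)).
Proof.
move=> T cF.
have [[UT VT]|UV] := pselect (U = setT /\ V = setT); [left|right].
  split=> //; split; last by move=> k [/andP[]].
  split; first by rewrite lexx ler01.
  exists idfun => //; apply/funext => x.
  have id0 A : closed_subspace A -> A = setT -> orthogonal_projection A x = x.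
    by move=> clA AT; rewrite orthogonal_projection_id// AT.
  rewrite /T /= !id0//.
  by rewrite subr0 scale1r scale0r addr0.
have c0 : 0 <= cF := cos_friedrichs_ge0 U V clU clV.
split; last by move=> k [k01 avk]; exact: averaged_ge.
split; last exact: averaged_composition_projections.
by rewrite divr_ge0 ?ler_pdivrMr//=; lra.
Qed.
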